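(* Let $X$ be a real Hilbert space, let $m\ge 2$ be an integer, let $T_1,\ldots,T_m\colon X\to X$ be firmly nonexpansive mappings, and let $\lambda_1,\ldots,\lambda_m\in\left]0,1\right[$ satisfy $\sum_{i=1}^m\lambda_i=1$. Suppose that each $T_i$ ($i\in\{1,\ldots,m\}$) is asymptotically regular. Then $\sum_{i=1}^m\lambda_iT_i$ is asymptotically regular as well.
   Context: Let $X$ be a real Hilbert space with inner product $\langle\cdot,\cdot\rangle$ and induced norm $\|\cdot\|$. A mapping $T\colon X\to X$ is firmly nonexpansive if $\|Tx-Ty\|^2\le\langle x-y,Tx-Ty\rangle$ for all $x,y\in X$. A mapping $S\colon X\to X$ is asymptotically regular if for every $x\in X$, $S^nx-S^{n+1}x\to 0$ strongly (in norm) as $n\to\infty$, where $S^n$ denotes the $n$-fold composition of $S$. *)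

(* Defs.v *)
From HB Require Import structures.
From mathcomp Require Import all_boot all_order all_algebra.
From mathcomp Require Import boolp classical_sets reals.
From mathcomp Require Import topology normedtype sequences.

Set Implicit Arguments.
Unset Strict Implicit.
Unset Printing Implicit Defensive.

Import Order.TTheory GRing.Theory Num.Theory.
Import numFieldNormedType.Exports.

Local Open Scope classical_set_scope.
Local Open Scope ring_scope.

(* A real Hilbert space is given as a complete normed space [X] over a
   [realType] together with a positive definite symmetric bilinear form
   [ip : {dot X for idfun}] that [induces_norm]. *)
Definition induces_norm (R : realType) (X : normedModType R)
    (ip : X -> X -> R) : Prop :=
  forall x : X, `|x| = Num.sqrt (ip x x).

Definition firmly_nonexpansive (R : realType) (X : normedModType R)
    (ip : X -> X -> R) (T : X -> X) : Prop :=
  forall x y : X, `|T x - T y| ^+ 2 <= ip (x - y) (T x - T y).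

Definition asymptotically_regular (R : realType) (X : normedModType R)
    (S : X -> X) : Prop :=
  forall x : X, (iter n S x - iter n.+1 S x) @[n --> \oo] --> (0 : X).

(* Main.v *)
(** Put [S := \sum_i lambda i *: T i]. Firm nonexpansiveness makes the squared
    distances between two orbits of [S] decrease by the squared differences of
    their displacements, so [S] is asymptotically regular as soon as
    [inf_x `|x - S x| = 0]. For the latter, let [delta > 0] and let [x] be the
    fixed point of the contraction [(1 + delta)^-1 *: S], so that
    [x - S x = - delta *: x]. Comparing [x] with points [y i] that [T i] moves by
    at most [eps], cocoercivity of [id - T i] bounds [delta *: x] by a multiple
    of [eps], once [delta] is small enough with respect to [eps] and the
    [`|y i|]. This is the Brezis-Haraux argument on the range of a sum of
    monotone operators, specialized to displacement maps. *)
Require Import Defs.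
From HB Require Import structures.
From mathcomp Require Import all_boot all_order all_algebra.
From mathcomp Require Import boolp classical_sets reals.
From mathcomp Require Import topology normedtype sequences.
From mathcomp Require Import functions interval_inference ring lra.

Set Implicit Arguments.
Unset Strict Implicit.
Unset Printing Implicit Defensive.

Import Order.TTheory GRing.Theory Num.Theory.
Import numFieldNormedType.Exports.

Local Open Scope classical_set_scope.
Local Open Scope ring_scope.

Section InnerProduct.
Context (R : realType) (X : normedModType R) (ip : {dot X for idfun})
  (hip : induces_norm ip).

Lemma ipC (u v : X) : ip u v = ip v u.
Proof. by rewrite hermC expr0 mul1r. Qed.

Lemma ip_normE (u : X) : ip u u = `|u| ^+ 2.
Proof.
rewrite hip sqr_sqrtr//; have [->|u0] := eqVneq u 0; first by rewrite linear0r.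
by rewrite ltW// neq0_dnorm_gt0.
Qed.

Lemma sqr_normB (u v : X) : `|u - v| ^+ 2 = `|u| ^+ 2 - 2 * ip u v + `|v| ^+ 2.
Proof.
rewrite -!ip_normE linearBr !linearBl/= (ipC v u).
ring.
Qed.

(** Expand [t^-1 * |t *: u - v|^2 >= 0]. *)
Lemma ip_young (t : R) (u v : X) : 0 < t ->
  2 * ip u v <= t * `|u| ^+ 2 + t^-1 * `|v| ^+ 2.
Proof.
move=> t0; have: 0 <= t^-1 * `|t *: u - v| ^+ 2.
  by rewrite mulr_ge0 ?sqr_ge0// invr_ge0 ltW.
rewrite sqr_normB linearZl_LR normrZ gtr0_norm//=.
suff -> : t^-1 * ((t * `|u|) ^+ 2 - 2 * (t * ip u v) + `|v| ^+ 2) =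
  t * `|u| ^+ 2 - 2 * ip u v + t^-1 * `|v| ^+ 2 by lra.
by field; rewrite gt_eqF.
Qed.

Lemma ip_suml (I : finType) (F : I -> X) (v : X) :
  ip (\sum_i F i) v = \sum_i ip (F i) v.
Proof.
by rewrite ipC raddf_sum/=; apply: eq_bigr => i _; rewrite ipC.
Qed.

(** The difference of the two sides is the variance [\sum_i c i * |F i - s|^2] of the [F i] about
    their mean [s]. *)
Lemma sqr_norm_convex (I : finType) (c : I -> R) (F : I -> X) :
  (forall i, 0 <= c i) -> \sum_i c i = 1 ->
  `|\sum_i c i *: F i| ^+ 2 <= \sum_i c i * `|F i| ^+ 2.
Proof.
move=> c0 c1; set s := \sum_i c i *: F i.
have : 0 <= \sum_i c i * `|F i - s| ^+ 2.
  by apply: sumr_ge0 => i _; rewrite mulr_ge0 ?sqr_ge0.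
suff -> : \sum_i c i * `|F i - s| ^+ 2 =
    \sum_i c i * `|F i| ^+ 2 - `|s| ^+ 2 by rewrite subr_ge0.
have -> : \sum_i c i * `|F i - s| ^+ 2 = \sum_i (c i * `|F i| ^+ 2
    - 2 * ip (c i *: F i) s + c i * `|s| ^+ 2).
  by apply: eq_bigr => i _; rewrite sqr_normB linearZl_LR/=; ring.
rewrite !big_split/= sumrN -mulr_suml c1 -mulr_sumr -ip_suml -/s ip_normE.
ring.
Qed.

Lemma firmly_nonexpansive_convex (I : finType) (c : I -> R) (T : I -> X -> X) :
  (forall i, 0 <= c i) -> \sum_i c i = 1 ->
  (forall i, firmly_nonexpansive ip (T i)) ->
  firmly_nonexpansive ip (fun x => \sum_i c i *: T i x).
Proof.
move=> c0 c1 hT x y; rewrite /= -sumrB.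
rewrite (eq_bigr (fun i => c i *: (T i x - T i y))) => [|i _]; last first.
  by rewrite scalerBr.
apply: le_trans (sqr_norm_convex _ c0 c1) _.
rewrite ipC ip_suml; apply: ler_sum => i _.
by rewrite linearZl_LR ler_wpM2l//= ipC; exact: hT.
Qed.

Section FirmlyNonexpansive.
Context (S : X -> X) (hS : firmly_nonexpansive ip S).

(** Beyond nonexpansiveness, this records how much distance is lost at each step; summing the losses
    along two orbits forces their displacements together. *)
Lemma fne_sqr_norm (x y : X) :
  `|S x - S y| ^+ 2 + `|(x - S x) - (y - S y)| ^+ 2 <= `|x - y| ^+ 2.
Proof.
have -> : x - S x - (y - S y) = x - y - (S x - S y).
  by rewrite !opprD !opprK addrACA.
by rewrite (sqr_normB (x - y)); have := hS x y; lra.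
Qed.

Lemma fne_nonexpansive (x y : X) : `|S x - S y| <= `|x - y|.
Proof.
rewrite -ler_sqr ?nnegrE//; apply: le_trans (fne_sqr_norm x y).
by rewrite lerDl sqr_ge0.
Qed.

(** Firm nonexpansiveness is symmetric under exchanging [S] and [id - S]; this is the cocoercivity
    of the displacement map. *)
Lemma fne_displacement (x y : X) : `|(x - S x) - (y - S y)| ^+ 2 <=
  ip ((x - S x) - (y - S y)) (x - y).
Proof.
have -> : x - S x - (y - S y) = x - y - (S x - S y).
  by rewrite !opprD !opprK addrACA.
have := hS x y; set d := x - y; set p := S x - S y => Sxy.
rewrite sqr_normB [ip (d - p) d]linearBl/= (ipC p d) (ip_normE d); lra.
Qed.

Lemma iter_displacement_le (x : X) (n k : nat) :
  `|iter (n + k) S x - iter (n + k).+1 S x| <= `|iter n S x - iter n.+1 S x|.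
Proof.
elim: k => [|k IH]; first by rewrite addn0.
by rewrite addnS; apply: le_trans IH; exact: fne_nonexpansive.
Qed.

Lemma fne_asymptotically_regular :
  (forall e : R, 0 < e -> exists y : X, `|y - S y| <= e) ->
  asymptotically_regular S.
Proof.
move=> hinf x; apply/cvgr0Pnorm_le => e e0.
have e20 : 0 < e / 2 by rewrite divr_gt0.
have [y hy] := hinf _ e20.
pose gap n := (iter n S x - iter n.+1 S x) - (iter n S y - iter n.+1 S y).
have [N hN] : exists n, `|gap n| <= e / 2.
  (* Otherwise the squared distance of the two orbits would drop by more than [(e / 2) ^+ 2] at
     every step and become negative. *)
  apply/not_existsP => far.
  have {far} far n : (e / 2) ^+ 2 < `|gap n| ^+ 2.
    by rewrite ltr_sqr ?nnegrE ?(ltW e20)// ltNge; apply/negP/far.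
  have dec n : `|iter n S x - iter n S y| ^+ 2 + n%:R * (e / 2) ^+ 2
      <= `|x - y| ^+ 2.
    elim: n => [|n IH]; first by rewrite mul0r addr0.
    have := fne_sqr_norm (iter n S x) (iter n S y).
    by have := far n; rewrite /gap/= -[n.+1%:R]natr1 mulrDl mul1r; lra.
  have sq0 : 0 < (e / 2) ^+ 2 by rewrite exprn_gt0.
  have := dec (Num.Def.archi_bound (`|x - y| ^+ 2 / (e / 2) ^+ 2)).
  apply/negP; rewrite -ltNge ltr_wpDl ?sqr_ge0//.
  by rewrite -ltr_pdivrMr// archi_boundP// divr_ge0 ?sqr_ge0.
exists N => // n /= /subnKC <-; apply: le_trans (iter_displacement_le x N _) _.
(* Split the displacement at time [N] into [gap N] and the displacement of the orbit of [y], each at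
   most [e / 2]. *)
rewrite -[leLHS](congr1 Num.norm (subrK (iter N S y - iter N.+1 S y) _)).
apply: le_trans (ler_normD _ _) _.
rewrite [leRHS]splitr lerD//.
by apply: le_trans hy; have := iter_displacement_le y 0 N; rewrite add0n.
Qed.

End FirmlyNonexpansive.
End InnerProduct.

(** Scaling by [(1 + d)^-1] makes [S] a strict contraction; its Banach fixed point satisfies
    [S x = (1 + d) *: x]. *)
Lemma nonexpansive_resolvent (R : realType) (X : completeNormedModType R)
    (S : X -> X) (d : R) :
  (forall x y, `|S x - S y| <= `|x - y|) -> 0 < d ->
  exists x, x - S x = - d *: x.
Proof.
move=> hS d0; have d10 : 0 < 1 + d by rewrite ltr_wpDl.
pose f : X -> X := fun x => (1 + d)^-1 *: S x.
pose F : {fun setT >-> setT} := [fun of totalfun f].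
have [|||x _] := @banach_fixed_point R X setT F.
- have q0 : 0 <= (1 + d)^-1 by rewrite invr_ge0 ltW.
  exists (NngNum q0); split => /=; first by rewrite invf_lt1// ltrDl.
  move=> [x y] _ /=; rewrite -scalerBr normrZ ger0_norm//.
  by rewrite ler_wpM2l.
- exact: closedT.
- by exists 0.
rewrite /F/= /f => fx; exists x.
have -> : S x = (1 + d) *: x by rewrite {2}fx scalerA divff ?scale1r// gt_eqF.
by rewrite scalerDl scale1r opprD addrA subrr sub0r scaleNr.
Qed.

Lemma convex_displacement_inf0 (R : realType) (X : completeNormedModType R)
    (ip : {dot X for idfun}) (hip : induces_norm ip) (I : finType)
    (c : I -> R) (T : I -> X -> X) :
  (forall i, 0 <= c i) -> \sum_i c i = 1 ->
  (forall i, firmly_nonexpansive ip (T i)) ->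
  (forall i (e : R), 0 < e -> exists y : X, `|y - T i y| <= e) ->
  forall e : R, 0 < e -> exists x, `|x - \sum_i c i *: T i x| <= e.
Proof.
move=> c0 c1 hT hinf e e0; have e20 : 0 < e / 2 by rewrite divr_gt0.
have [y hy] := choice (fun i => hinf i _ e20).
pose C := \sum_i c i * (`|y i| ^+ 2 / 4).
have C0 : 0 <= C.
  by apply: sumr_ge0 => i _; rewrite mulr_ge0// divr_ge0 ?sqr_ge0.
(* The [y i], hence [C], are fixed before [d]. This choice gives [2 * d * C <= (e / 2) ^+ 2], and
   the [+ 1] keeps the divisor positive when [C = 0]. *)
have [d d0 dC] : exists2 d, 0 < d & d * (2 * C + 1) = (e / 2) ^+ 2.
  exists ((e / 2) ^+ 2 / (2 * C + 1)); first by rewrite divr_gt0 ?exprn_gt0//; lra.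
  by rewrite divfK// gt_eqF//; lra.
have hS := firmly_nonexpansive_convex hip c0 c1 hT.
have [x hx] := nonexpansive_resolvent (fne_nonexpansive hip hS) d0.
exists x; rewrite hx normrZ normrN gtr0_norm//.
(* By Young's inequality, K bounds [- ip x a] whenever [`|a| <= e / 2]. *)
have [K KE] : exists K, K = d / 2 * `|x| ^+ 2 + (e / 2) ^+ 2 / (2 * d).
  by eexists.
have term i : 0 <= ip (x - T i x) x + K + `|y i| ^+ 2 / 4.
  have := hy i; have := fne_displacement hip (hT i) x (y i).
  move: (x - T i x) (y i - T i (y i)) => u a hua ha.
  have : d^-1 * `|a| ^+ 2 <= d^-1 * (e / 2) ^+ 2.
    by rewrite ler_wpM2l ?invr_ge0 ?(ltW d0)// ler_sqr ?nnegrE ?(ltW e20).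
  (* With weight 2, half of Young's bound is [|u - a|^2 + |y i|^2 / 4]; cocoercivity absorbs the
     first term. *)
  have := ip_young hip (u - a) (- y i) (ltr0Sn R 1).
  have := ip_young hip x (- a) d0; move: hua.
  rewrite KE !normrN [ip _ (x - y i)]linearBr !linearNr !linearBl/= (ipC ip x a).
  rewrite invfM; lra.
(* Average [term] with weights [c i]: the displacements [x - T i x] average to [- d *: x]. *)
have dx2 : 0 <= - d * `|x| ^+ 2 + K + C.
  have : 0 <= \sum_i c i * (ip (x - T i x) x + K + `|y i| ^+ 2 / 4).
    by apply: sumr_ge0 => i _; rewrite mulr_ge0.
  under eq_bigr do rewrite !mulrDr -[c _ * ip _ _](linearZl_LR ip).
  rewrite !big_split/= -mulr_suml c1 mul1r -(ip_suml ip) -/C.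
  under eq_bigr do rewrite scalerBr.
  by rewrite sumrB -scaler_suml c1 scale1r hx linearZl_LR/= (ip_normE hip).
rewrite -ler_sqr ?nnegrE ?(ltW e0)// ?mulr_ge0 ?(ltW d0)//.
(* [K] uses up only half of [d * |x|^2]; multiplying by [2 * d] turns the remaining half into
   [(d * |x|) ^+ 2]. *)
have : 0 <= 2 * d * (- d * `|x| ^+ 2 + K + C) by rewrite mulr_ge0// mulr_ge0// ltW.
have -> : 2 * d * (- d * `|x| ^+ 2 + K + C) =
    (e / 2) ^+ 2 + 2 * d * C - (d * `|x|) ^+ 2.
  by rewrite KE; field; rewrite gt_eqF.
have := sqr_ge0 (e / 2); have -> : e ^+ 2 = 4 * (e / 2) ^+ 2 by field.
lra.
Qed.

Theorem theorem5p5 (R : realType) (X : completeNormedModType R)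
    (ip : {dot X for idfun}) (hip : induces_norm ip)
    (m : nat) (hm : (2 <= m)%N)
    (T : 'I_m -> X -> X) (hT : forall i, firmly_nonexpansive ip (T i))
    (lambda : 'I_m -> R) (hlambda : forall i, 0 < lambda i < 1)
    (hsum : \sum_(i < m) lambda i = 1)
    (hreg : forall i, asymptotically_regular (T i)) :
  asymptotically_regular (fun x : X => \sum_(i < m) lambda i *: T i x).
Proof.
have l0 i : 0 <= lambda i by have /andP[/ltW] := hlambda i.
apply: (fne_asymptotically_regular hip).
  exact: firmly_nonexpansive_convex.
apply: (convex_displacement_inf0 hip) => // i e e0.
(* Any orbit of [T i] reaches points of small displacement; the one starting at 0 is taken. *)
have /cvgr0Pnorm_le/(_ e e0)[N _ hN] := hreg i 0.
by exists (iter N (T i) 0); exact: hN (leqnn N).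
Qed.
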